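(* Let $n\ge 3$ and $N_1,N_2\ge 0$ be integers. The image of the set of $\mathcal{G}_{-N_1}^{N_2}(2n)$-monomials in $AQ_{-N_1}^{N_2}(2n)$ is a basis of $AQ_{-N_1}^{N_2}(2n)$ over $\mathbb{C}$. Thus $AQ_{-N_1}^{N_2}(2n)$ is an algebra with straightened law (with respect to the lattice $\mathcal{G}_{-N_1}^{N_2}(2n)$).
   Context: The algebra: consider the polynomial ring over $\mathbb{C}$ in variables $f^i[s],g_j[t]$, $1\le i,j\le n$, $-N_1\le s,t\le N_2$. Then $$AQ_{-N_1}^{N_2}(2n)=\mathbb{C}[f^i[s],g_j[t]]/(r[-2N_1],\dots,r[2N_2]),\qquad r[l]=\sum_{s+t=l}\sum_{i=1}^n f^i[s]g_i[t],$$ graded by the degree in the variables. The poset: for $n\ge 3$ let $\hat{\mathcal G}(2n)$ be the set of symbols $f^i[t],g_i[t]$ ($1\le i\le n$, $t\in\mathbb{Z}$) with the partial order (reflexive, transitive) generated by the following covering relations, for all $t\in\mathbb{Z}$: $f^{i+1}[t]<f^{i}[t]$ for $1\le i\le n-1$; $f^2[t]<g_1[t]$; $f^1[t]<g_2[t]$; $g_i[t]<g_{i+1}[t]$ for $1\le i\le n-1$; $g_{n-1}[t]<f^n[t+1]$; $g_n[t]<f^{n-1}[t+1]$. (So the only incomparable pairs are $\{f^1[t],g_1[t]\}$ and $\{g_n[t],f^n[t+1]\}$.) The finite poset $\mathcal{G}_{-N_1}^{N_2}(2n)$ is the interval $\{\gamma\in\hat{\mathcal G}(2n): f^n[-N_1]\le\gamma\le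 g_n[N_2]\}$; its elements are exactly the $f^i[t],g_i[t]$ with $-N_1\le t\le N_2$, i.e. the generators of the algebra. It is a lattice (any two elements have a unique supremum $\vee$ and a unique infimum $\wedge$). Monomials: a monomial in generators labelled by a poset $\mathcal G$ is called a $\mathcal G$-monomial if the elements of its support (the set of generators occurring in it) are pairwise comparable. Algebra with straightened law: let $\mathcal G$ be a finite lattice and $B=\bigoplus_{i\ge 0}B_i$ a graded commutative algebra generated by $B_1$, where $B_1$ has a basis $\{e_\alpha\}_{\alpha\in\mathcal G}$. Suppose that for all incomparable $\alpha,\beta\in\mathcal{G}$ relations of the following form hold in $B$: $$e_\alpha e_\beta=c_{\alpha\vee\beta,\alpha\wedge\beta}\,e_{\alpha\vee\beta}e_{\alpha\wedge\beta}+\sum_{\gamma\ge\alpha\vee\beta,\ \gamma'\le\alpha\wedge\beta}c_{\gamma,\gamma'}\,e_\gamma e_{\gamma'}$$ with scalar coefficients. Then $B$ is called an algebra with straightened law if the images of the $\mathcal G$-monomials form a basis of $B$. *)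

(* Defs.v *)
From HB Require Import structures.
From Stdlib Require Import Relation_Operators.
From mathcomp Require Import all_boot all_order all_algebra.
From mathcomp Require Import ring_quotient zify.
From mathcomp Require Import boolp mpoly.

Set Implicit Arguments.
Unset Strict Implicit.
Unset Printing Implicit Defensive.

Import Order.TTheory GRing.Theory Num.Theory.
Local Open Scope ring_scope.

Section LinearAlgebra.
Variables (K : fieldType) (V : lmodType K) (I : eqType).
Implicit Types (e : I -> V) (W : V -> Prop).

Definition lin_indep e : Prop :=
  forall (s : seq I) (c : I -> K), uniq s ->
    \sum_(i <- s) c i *: e i = 0 -> forall i, i \in s -> c i = 0.

Definition spans e W : Prop :=
  forall v, W v <-> exists (s : seq I) (c : I -> K), v = \sum_(i <- s) c i *: e i.

(* Bases are families: in particular [e] is injective. *)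
Definition is_basis e W : Prop := lin_indep e /\ spans e W.

End LinearAlgebra.

Record is_grading (K : fieldType) (B : comAlgType K) (gr : nat -> B -> Prop) :
    Prop := IsGrading {
  grading0 : forall d, gr d 0;
  gradingP : forall d (a : K) x y, gr d x -> gr d y -> gr d (a *: x + y);
  grading1 : gr 0 1;
  gradingM : forall d d' x y, gr d x -> gr d' y -> gr (d + d')%N (x * y);
  grading_sum : forall b, exists m (c : nat -> B),
    (forall d, gr d (c d)) /\ b = \sum_(d < m) c d;
  grading_direct : forall m (c : nat -> B), (forall d, gr d (c d)) ->
    \sum_(d < m) c d = 0 -> forall d, (d < m)%N -> c d = 0 }.

Definition generates (K : fieldType) (B : comAlgType K) (W : B -> Prop) : Prop :=
  forall S : {pred B}, GRing.subalg_closed S -> (forall b, W b -> b \in S) ->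
    forall b, b \in S.

(* A monomial in generators labelled by [G] is given by its exponents. *)
Definition monomial (B : comPzRingType) (G : finType) (e : G -> B)
    (m : {ffun G -> nat}) : B :=
  \prod_(a : G) e a ^+ m a.

Definition comparable_support disp (G : finPOrderType disp)
    (m : {ffun G -> nat}) : bool :=
  [forall a, forall b, (m a != 0%N) && (m b != 0%N) ==> (a >=< b)%O].

Definition poset_monomial disp (G : finPOrderType disp) : Type :=
  {m : {ffun G -> nat} | comparable_support m}.

HB.instance Definition _ disp (G : finPOrderType disp) :=
  Choice.on (poset_monomial G).

(* The type of [G], its lattice operations being those of the library, carries
   the assumption that the labelling poset is a finite lattice. *)
Record straightened_law disp (G : finLatticeType disp) (K : fieldType)
    (B : comAlgType K) (gr : nat -> B -> Prop) (e : G -> B) : Prop :=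
    StraightenedLaw {
  sl_grading : is_grading gr;
  sl_generated : generates (gr 1%N);
  sl_basis1 : is_basis e (gr 1%N);
  sl_relations : forall a b : G, ~~ (a >=< b)%O ->
    exists (c0 : K) (c : G -> G -> K),
      e a * e b =
        c0 *: (e (a `|` b)%O * e (a `&` b)%O)
        + \sum_(x : G | (a `|` b <= x)%O) \sum_(y : G | (y <= a `&` b)%O)
            c x y *: (e x * e y);
  sl_monomials :
    is_basis (fun m : poset_monomial G => monomial e (val m)) (fun=> True) }.

Arguments straightened_law {disp} G {K B} gr e.

(* The symbols f^i[t], g_i[t] with t in T; the ordinal i : 'I_n stands for the
   index i + 1 of the usual notation, where indices run from 1 to n. *)
Inductive symbol (n : nat) (T : Type) : Type :=
| Sf of 'I_n & T
| Sg of 'I_n & T.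

Definition symbol_sum n T (x : symbol n T) : 'I_n * T + 'I_n * T :=
  match x with Sf i t => inl (i, t) | Sg i t => inr (i, t) end.

Definition sum_symbol n T (x : 'I_n * T + 'I_n * T) : symbol n T :=
  match x with inl (i, t) => Sf i t | inr (i, t) => Sg i t end.

Lemma symbol_sumK n T : cancel (@symbol_sum n T) (@sum_symbol n T).
Proof. by case. Qed.

HB.instance Definition _ n (T : countType) :=
  Countable.copy (symbol n T) (can_type (@symbol_sumK n T)).
HB.instance Definition _ n (T : finType) :=
  Finite.copy (symbol n T) (can_type (@symbol_sumK n T)).

Definition symbol_map n (T U : Type) (h : T -> U) (x : symbol n T) : symbol n U :=
  match x with Sf i t => Sf i (h t) | Sg i t => Sg i (h t) end.

Inductive cover (n : nat) : symbol n int -> symbol n int -> Prop :=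
(* f^{i+1}[t] < f^i[t] *)
| cover_ff (i j : 'I_n) t : j = i.+1 :> nat -> cover (Sf j t) (Sf i t)
(* f^2[t] < g_1[t] *)
| cover_f2g1 (i j : 'I_n) t : i = 1%N :> nat -> j = 0%N :> nat ->
    cover (Sf i t) (Sg j t)
(* f^1[t] < g_2[t] *)
| cover_f1g2 (i j : 'I_n) t : i = 0%N :> nat -> j = 1%N :> nat ->
    cover (Sf i t) (Sg j t)
(* g_i[t] < g_{i+1}[t] *)
| cover_gg (i j : 'I_n) t : j = i.+1 :> nat -> cover (Sg i t) (Sg j t)
(* g_{n-1}[t] < f^n[t+1] *)
| cover_gf (i j : 'I_n) t : i.+2 = n -> j.+1 = n ->
    cover (Sg i t) (Sf j (t + 1))
(* g_n[t] < f^{n-1}[t+1] *)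
| cover_gf' (i j : 'I_n) t : i.+1 = n -> j.+2 = n ->
    cover (Sg i t) (Sf j (t + 1)).

Definition le_symbol n : symbol n int -> symbol n int -> Prop :=
  clos_refl_trans _ (@cover n).

(* The integers t with - N1 <= t <= N2, shifted by N1. *)
Definition time (N1 N2 : nat) : Type := 'I_(N1 + N2).+1.
HB.instance Definition _ N1 N2 := Finite.on (time N1 N2).

Definition time_int N1 N2 (t : time N1 N2) : int := (t : 'I__)%:Z - N1%:Z.

Definition gen (n N1 N2 : nat) : Type := symbol n (time N1 N2).
HB.instance Definition _ n N1 N2 := Finite.on (gen n N1 N2).

Definition gen_symbol n N1 N2 : gen n N1 N2 -> symbol n int :=
  symbol_map (@time_int N1 N2).

Section Order.
Variables (n : nat) (n_ge3 : (3 <= n)%N).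
Implicit Types x y z : symbol n int.

Let P : int := (n + n - 2)%:Z.

Definition rank x : int :=
  match x with
  | Sf i t => P * t + (n%:Z - 1 - (i : nat)%:Z)
  | Sg i t => P * t + (n%:Z - 1 + (i : nat)%:Z)
  end.

Lemma mulP_inj (s t a b : int) : P * s + a = P * t + b ->
  s = t /\ a = b \/ s = t + 1 /\ b = a + P \/ t = s + 1 /\ a = b + P \/
    b >= a + 2 * P \/ a >= b + 2 * P.
Proof.
have P0 : P >= 4 by rewrite /P; lia.
move=> e; have e2 : P * (s - t) = b - a by move: e; rewrite mulrBr; lia.
have [d0|d0|d0] := ltrgtP (s - t) 0.
- have [d1|d1] := eqVneq (s - t) (-1).
    by move: e2; rewrite d1; lia.
  by do 4!right; nia.
- have [d1|d1] := eqVneq (s - t) 1.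
    by move: e2; rewrite d1; lia.
  by do 3!right; left; nia.
by move: e2; rewrite d0; lia.
Qed.

Lemma cover_rank x y : cover x y -> rank y = rank x + 1.
Proof. by case=> i j t *; rewrite /rank /P; lia. Qed.

Lemma rank_cover x y : rank y = rank x + 1 -> cover x y.
Proof.
case: x => i s; case: y => j t; rewrite /rank => e0;
  have {e0} e := mulP_inj (etrans e0 (esym (addrA _ _ _)));
  have := ltn_ord i; have := ltn_ord j => lj li; rewrite /P in e.
- have [-> ?] : t = s /\ i = j.+1 :> nat by lia.
  exact: cover_ff.
- have [-> [] []] : t = s /\ (i = 1%N :> nat /\ j = 0%N :> nat
    \/ i = 0%N :> nat /\ j = 1%N :> nat) by lia.
    exact: cover_f2g1.
  exact: cover_f1g2.
- have [-> [] []] : t = s + 1 /\ (i.+2 = n /\ j.+1 = n \/ i.+1 = n /\ j.+2 = n)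
    by lia.
    exact: cover_gf.
  exact: cover_gf'.
- have [-> ?] : t = s /\ j = i.+1 :> nat by lia.
  exact: cover_gg.
Qed.

Lemma rank_surj (r : int) : exists x, rank x = r.
Proof.
have P0 : P != 0 by rewrite /P; lia.
have e := divz_eq r P; have k0 := modz_ge0 r P0.
have k1 : ((r %% P)%Z < P) by apply: ltz_pmod; rewrite /P; lia.
case: (leP (r %% P)%Z (n%:Z - 1)) => h.
  have l : (absz (n%:Z - 1 - (r %% P)%Z)%R < n)%N by lia.
  by exists (Sf (Ordinal l) (r %/ P)%Z); rewrite /rank /= [RHS]e; lia.
have l : (absz ((r %% P)%Z - (n%:Z - 1))%R < n)%N by rewrite /P in k1 *; lia.
by exists (Sg (Ordinal l) (r %/ P)%Z); rewrite /rank /= [RHS]e; lia.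
Qed.

Lemma le_symbol_rank x y : le_symbol x y <-> x = y \/ rank x < rank y.
Proof.
split.
  elim=> {x y} [x y /cover_rank|x|x y z _ IH1 _ IH2]; first by right; lia.
    by left.
  by case: IH1 => [->|h] //; case: IH2 => [<-|h']; right; lia.
case=> [->|]; first exact: rt_refl.
move=> h; have {h} [k] : exists k : nat, rank y = rank x + k%:Z + 1.
  by exists (absz (rank y - rank x - 1)%R); lia.
elim: k x => [|k IH] x e; first by apply/rt_step/rank_cover; lia.
have [z ez] := rank_surj (rank x + 1).
apply: (rt_trans _ _ _ z); first exact/rt_step/rank_cover.
by apply: IH; lia.
Qed.

(* Incomparable symbols have the same rank; the levels just above and just below
   are then reduced to one element. *)
Lemma same_rank x y : rank x = rank y -> x = y \/
  exists (i0 i1 : 'I_n) t, [/\ (i0 = 0 :> nat)%N, (i1 = 1 :> nat)%N &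
     x = Sf i0 t /\ y = Sg i0 t \/ x = Sg i0 t /\ y = Sf i0 t]
  \/ [/\ i0.+1 = n, i1.+2 = n &
     x = Sg i0 t /\ y = Sf i0 (t + 1) \/ x = Sf i0 (t + 1) /\ y = Sg i0 t].
Proof.
have l0 : (0 < n)%N by lia.
have l1 : (1 < n)%N by lia.
have m0 : (n.-1 < n)%N by lia.
have m1 : (n.-2 < n)%N by lia.
have ordE (i j : 'I_n) : i = j :> nat -> i = j by exact: val_inj.
case: x => i s; case: y => j t; rewrite /rank => /mulP_inj e;
  have := ltn_ord i; have := ltn_ord j => lj li; rewrite /P in e.
- by left; congr Sf; [apply: ordE|]; lia.
- right; have [h|h] : s = t /\ i = 0%N :> nat /\ j = 0%N :> nat \/
    s = t + 1 /\ i.+1 = n /\ j.+1 = n by lia.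
    case: h => -> [hi hj]; exists i, (Ordinal l1), t; left; split=> //; left.
    by split=> //; congr Sg; apply: ordE; lia.
  case: h => -> [hi hj]; exists i, (Ordinal m1), t; right; split=> //=; first lia.
  by right; split=> //; congr Sg; apply: ordE; lia.
- right; have [h|h] : s = t /\ i = 0%N :> nat /\ j = 0%N :> nat \/
    t = s + 1 /\ i.+1 = n /\ j.+1 = n by lia.
    case: h => -> [hi hj]; exists i, (Ordinal l1), t; left; split=> //; right.
    by split=> //; congr Sf; apply: ordE; lia.
  case: h => -> [hi hj]; exists i, (Ordinal m1), s; right; split=> //=; first lia.
  by left; split=> //; congr Sf; apply: ordE; lia.
- by left; congr Sg; [apply: ordE|]; lia.
Qed.

End Order.

(* The generators are exactly the elements of the interval [f^n[-N1], g_n[N2]];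
   [i] is the last index. *)
Lemma gen_interval n N1 N2 (i : 'I_n) (x : symbol n int) :
    (3 <= n)%N -> i.+1 = n ->
  le_symbol (Sf i (- N1%:Z)) x /\ le_symbol x (Sg i N2%:Z) <->
  exists y : gen n N1 N2, gen_symbol y = x.
Proof.
move=> n3 hi; rewrite !le_symbol_rank // /rank.
pose P : int := (n + n - 2)%:Z.
have P0 : P >= 4 by rewrite /P; lia.
have bound (t a : int) : 0 <= a <= P -> - N1%:Z <= t <= N2%:Z ->
    P * - N1%:Z <= P * t + a <= P * N2%:Z + P.
  by move=> *; nia.
have mk (t : int) : - N1%:Z <= t <= N2%:Z ->
    exists s : time N1 N2, time_int s = t.
  move=> h; have l : (absz (t + N1%:Z)%R < (N1 + N2).+1)%N by lia.
  by exists (Ordinal l); rewrite /time_int /=; lia.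
split.
  case: x => j t; have lj := ltn_ord j; rewrite -/P => -[h1 h2].
    have /mk [s <-] : - N1%:Z <= t <= N2%:Z.
      have {}h1 : P * - N1%:Z <= P * t + (n%:Z - 1 - (j : nat)%:Z).
        by case: h1 => [[<- <-]|]; lia.
      have {}h2 : P * t + (n%:Z - 1 - (j : nat)%:Z) < P * N2%:Z + P.
        by case: h2 => [//|]; rewrite /P; lia.
      by move: h1 h2; rewrite /P; nia.
    by exists (Sf j s).
  have /mk [s <-] : - N1%:Z <= t <= N2%:Z.
    have {}h1 : P * - N1%:Z < P * t + (n%:Z - 1 + (j : nat)%:Z).
      by case: h1 => [//|]; lia.
    have {}h2 : P * t + (n%:Z - 1 + (j : nat)%:Z) <= P * N2%:Z + P.
      by case: h2 => [[-> ->]|]; rewrite /P; lia.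
    by move: h1 h2; rewrite /P; nia.
  by exists (Sg j s).
case=> y <-; rewrite -/P; case: y => j s /=; have lj := ltn_ord j;
  have ls := ltn_ord (s : 'I__); rewrite /time_int; set t : int := _ - _;
  have ht : - N1%:Z <= t <= N2%:Z by rewrite /t; lia.
- have /bound/(_ ht) : 0 <= n%:Z - 1 - (j : nat)%:Z <= P by rewrite /P; lia.
  move=> hb; split.
    have [tE|tN] := eqVneq t (- N1%:Z); last by right; nia.
    have [jE|jN] := eqVneq j i; first by left; rewrite tE jE.
    have {}jN : (j : nat) != i by [].
    by right; rewrite tE; lia.
  by right; nia.
have /bound/(_ ht) : 0 <= n%:Z - 1 + (j : nat)%:Z <= P by rewrite /P; lia.
move=> hb; split; first by right; nia.
have [tE|tN] := eqVneq t (N2%:Z); last by right; nia.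
have [jE|jN] := eqVneq j i; first by left; rewrite tE jE.
have {}jN : (j : nat) != i by [].
by right; rewrite tE; lia.
Qed.

Fact gposet_display : Order.disp_t. Proof. exact: Order.Disp tt tt. Qed.

Section GenPoset.
Variables (n N1 N2 : nat) (n_ge3 : (3 <= n)%N).

(* The proof of 3 <= n is a parameter because the lattice structure needs it. *)
Definition gposet of (3 <= n)%N : Type := gen n N1 N2.
Local Notation G := (gposet n_ge3).
HB.instance Definition _ := Finite.on G.
Implicit Types x y z : G.

Definition gle : rel G := fun x y => `[< le_symbol (gen_symbol x) (gen_symbol y) >].

Let rk x : int := rank (gen_symbol x).

Lemma gen_symbol_inj : injective (@gen_symbol n N1 N2).
Proof.
by case=> i s [] j t //= [-> /(@addIr _ _) [/val_inj->]].
Qed.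

Lemma gleP x y : reflect (x = y \/ rk x < rk y) (gle x y).
Proof.
apply: (iffP (asboolP _)); rewrite (le_symbol_rank n_ge3).
  by case=> [/gen_symbol_inj|]; [left|right].
by case=> [->|]; [left|right].
Qed.

Lemma gle_refl : reflexive gle.
Proof. by move=> x; apply/gleP; left. Qed.

Lemma gle_anti : antisymmetric gle.
Proof. by move=> x y /andP[/gleP[//|h] /gleP[//|h']]; lia. Qed.

Lemma gle_trans : transitive gle.
Proof.
move=> y x z /gleP[->//|h] /gleP[<-|h']; apply/gleP; first by right.
by right; lia.
Qed.

HB.instance Definition _ :=
  Order.Le_isPOrder.Build gposet_display G gle_refl gle_anti gle_trans.

Lemma gposet_bounds x y : exists z w,
  (forall u, (x <= u)%O && (y <= u)%O = (z <= u)%O) /\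
  (forall u, (u <= x)%O && (u <= y)%O = (u <= w)%O).
Proof.
case: (ltrgtP (rk x) (rk y)) => h.
- have xy : (x <= y)%O by apply/gleP; right.
  exists y, x; split=> u; apply/andP/idP => [[]//|h']; split=> //.
    exact: le_trans h'.
  exact: le_trans xy.
- have yx : (y <= x)%O by apply/gleP; right.
  exists x, y; split=> u; apply/andP/idP => [[]//|h']; split=> //.
    exact: le_trans h'.
  exact: le_trans yx.
have [->|xy] := eqVneq x y.
  by exists y, y; split=> u; rewrite andbb.
suff [z [w [hz uz hw uw]]] : exists z w, [/\ rk z = rk x + 1,
    forall u, rk u = rk x + 1 -> u = z, rk w = rk x - 1 &
    forall u, rk u = rk x - 1 -> u = w].
  exists z, w; split=> u.
    apply/andP/gleP => [[/gleP hx /gleP hy]|hu].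
      have hu : rk x < rk u.
        by case: hx hy => [<-|//] [e|]; [rewrite e eqxx in xy|lia].
      have [e|ne] := eqVneq (rk u) (rk x + 1); last by right; lia.
      by left; rewrite (uz _ e).
    have hu' : rk x < rk u by case: hu => [<-|]; lia.
    by split; apply/gleP; right; lia.
  apply/andP/gleP => [[/gleP hx /gleP hy]|hu].
    have hu : rk u < rk x.
      by case: hx hy => [->|//] [e|]; [rewrite e eqxx in xy|lia].
    have [e|ne] := eqVneq (rk u) (rk x - 1); last by right; lia.
    by left; rewrite (uw _ e).
  have hu' : rk u < rk x by case: hu => [->|]; lia.
  by split; apply/gleP; right; lia.
have uniq_rk z : (forall v, rank v = rk z -> v = gen_symbol z) ->
    forall u, rk u = rk z -> u = z.
  by move=> hz u e; apply/gen_symbol_inj/hz.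
suff [z [w [hz uz hw uw]]] : exists z w : G, [/\ rk z = rk x + 1,
    forall u, rank u = rk z -> u = gen_symbol z, rk w = rk x - 1 &
    forall u, rank u = rk w -> u = gen_symbol w].
  exists z, w; split=> // u; rewrite -?hz -?hw; exact: uniq_rk.
have single (i i' : 'I_n) (t t' : int) (u v : symbol n int) :
    v = Sf i t \/ v = Sg i t -> i != 0%N :> nat -> i.+1 != n ->
    rank u = rank v -> u = v.
  move=> hv hi hi' /(same_rank n_ge3)[//|[i0 [i1 [t0 H]]]].
  have e : i0 = i.
    by case: H => -[_ _ [] []] _; case: hv => -> // [].
  by case: H => -[e0 _ _]; rewrite -e e0 eqxx in hi hi'.
have /(same_rank n_ge3) [/gen_symbol_inj e|] := h; first by rewrite e eqxx in xy.
case=> i0 [i1 [t [[h0 h1 H]|[h0 h1 H]]]].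
  have [s hx] : exists s, x = Sf i0 s \/ x = Sg i0 s.
    by case: H; case: (x) => i s -[] // [-> _] _; exists s; [left|right].
  have nz : (i1 : nat) != 0%N by rewrite h1.
  have nn : i1.+1 != n by rewrite h1; lia.
  exists (Sg i1 s), (Sf i1 s); split.
  - by case: hx => ->; rewrite /rk /rank /= h0 h1; lia.
  - by move=> u; apply: (single i1 i1 (time_int s) 0) => //; right.
  - by case: hx => ->; rewrite /rk /rank /= h0 h1; lia.
  - by move=> u; apply: (single i1 i1 (time_int s) 0) => //; left.
have [s [s' [es hx]]] : exists s s' : time N1 N2, time_int s' = time_int s + 1 /\
    (x = Sf i0 s' \/ x = Sg i0 s).
  case: H; case: (x) => i s; case: (y) => i' s' /= [] // [-> e] [_ e'].
    by exists s, s'; rewrite e e'; split=> //; right.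
  by exists s', s; rewrite e e'; split=> //; left.
have nz : (i1 : nat) != 0%N by lia.
have nn : i1.+1 != n by lia.
exists (Sf i1 s'), (Sg i1 s); split.
- by case: hx => ->; rewrite /rk /rank /= ?es; lia.
- by move=> u; apply: (single i1 i1 (time_int s') 0) => //; left.
- by case: hx => ->; rewrite /rk /rank /= ?es; lia.
- by move=> u; apply: (single i1 i1 (time_int s) 0) => //; right.
Qed.

Lemma gposet_join x y : exists z, `[< forall u, (z <= u)%O = (x <= u)%O && (y <= u)%O >].
Proof. by have [z [_ [h _]]] := gposet_bounds x y; exists z; apply/asboolP. Qed.

Lemma gposet_meet x y : exists z, `[< forall u, (u <= z)%O = (u <= x)%O && (u <= y)%O >].
Proof. by have [_ [z [_ h]]] := gposet_bounds x y; exists z; apply/asboolP. Qed.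

Let join x y := xchoose (gposet_join x y).
Let meet x y := xchoose (gposet_meet x y).

Let joinP x y z : (join x y <= z)%O = (x <= z)%O && (y <= z)%O.
Proof. by have /asboolP := xchooseP (gposet_join x y). Qed.

Let meetP x y z : (x <= meet y z)%O = (x <= y)%O && (x <= z)%O.
Proof. by have /asboolP := xchooseP (gposet_meet y z). Qed.

HB.instance Definition _ := Order.POrder_MeetJoin_isLattice.Build
  gposet_display G meetP joinP.

End GenPoset.

Section AQ.
Variables (K : fieldType) (n N1 N2 : nat).
Local Notation S := {mpoly K[#|{: gen n N1 N2}|]}.

Definition var (a : gen n N1 N2) : S := 'X_(enum_rank a).

Definition rel_r (l : int) : S :=
  \sum_(s : time N1 N2) \sum_(t : time N1 N2 | time_int s + time_int t == l)
    \sum_(i < n) var (Sf i s) * var (Sg i t).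

(* The ideal (r[-2 N1], ..., r[2 N2]). *)
Definition AQ_ideal : {pred S} := fun p =>
  `[< exists c : nat -> S, p =
        \sum_(k < (2 * (N1 + N2)).+1) c k * rel_r (k%:Z - (2 * N1)%:Z) >].

Lemma AQ_ideal_closed : idealr_closed AQ_ideal.
Proof.
split.
- apply/asboolP; exists (fun=> 0); rewrite big1 // => k _; exact: mul0r.
- apply/negP => /asboolP [c] /(congr1 (meval (fun=> 0))).
  rewrite meval1 raddf_sum /= big1 => [/eqP|k _]; first by rewrite oner_eq0.
  rewrite mevalM /rel_r raddf_sum big1 ?mulr0 // => s _.
  rewrite raddf_sum big1 // => t _; rewrite raddf_sum big1 // => i _.
  by rewrite /= mevalM /var mevalXU mul0r.
move=> a u v /asboolP [c ->] /asboolP [d ->]; apply/asboolP.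
exists (fun k => a * c k + d k); rewrite mulr_sumr -big_split /=.
by apply: eq_bigr => k _; rewrite mulrDl mulrA.
Qed.

HB.instance Definition _ := isIdealr.Build S AQ_ideal AQ_ideal_closed.

Definition AQ : Type := {ideal_quot AQ_ideal}.
HB.instance Definition _ := GRing.ComNzRing.on AQ.

Definition AQ_pi : S -> AQ := \pi_({ideal_quot AQ_ideal})%qT.

Lemma AQ_pi_zmod : zmod_morphism AQ_pi.
Proof. by move=> x y; rewrite /AQ_pi raddfB. Qed.
Lemma AQ_pi_monoid : monoid_morphism AQ_pi.
Proof. by split=> [|x y]; rewrite /AQ_pi ?rmorph1 ?rmorphM. Qed.
HB.instance Definition _ := GRing.isZmodMorphism.Build S AQ AQ_pi AQ_pi_zmod.
HB.instance Definition _ := GRing.isMonoidMorphism.Build S AQ AQ_pi AQ_pi_monoid.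

Definition AQ_scale (a : K) (x : AQ) : AQ := AQ_pi a%:MP * x.

Lemma AQ_scaleA a b x : AQ_scale a (AQ_scale b x) = AQ_scale (a * b) x.
Proof. by rewrite /AQ_scale mulrA -rmorphM -mpolyCM. Qed.
Lemma AQ_scale1 : left_id 1 AQ_scale.
Proof. by move=> x; rewrite /AQ_scale mpolyC1 rmorph1 mul1r. Qed.
Lemma AQ_scaleDr : right_distributive AQ_scale +%R.
Proof. by move=> a x y; rewrite /AQ_scale mulrDr. Qed.
Lemma AQ_scaleDl x : {morph AQ_scale^~ x : a b / a + b}.
Proof. by move=> a b; rewrite /AQ_scale mpolyCD rmorphD mulrDl. Qed.
HB.instance Definition _ := GRing.Zmodule_isLmodule.Build K AQ
  AQ_scaleA AQ_scale1 AQ_scaleDr AQ_scaleDl.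

Lemma AQ_scaleAl (a : K) (x y : AQ) : a *: (x * y) = (a *: x) * y.
Proof. exact: mulrA. Qed.
HB.instance Definition _ := GRing.Lmodule_isLalgebra.Build K AQ AQ_scaleAl.
HB.instance Definition _ := GRing.Lalgebra_isComAlgebra.Build K AQ.

Lemma AQ_pi_scalable : scalable AQ_pi.
Proof. by move=> a x; rewrite -mul_mpolyC rmorphM. Qed.
HB.instance Definition _ := GRing.isScalable.Build K S AQ *:%R AQ_pi AQ_pi_scalable.

Definition AQ_grading (d : nat) (b : AQ) : Prop :=
  exists2 p : S, p \is d.-homog & b = AQ_pi p.

Definition AQ_gen (a : gen n N1 N2) : AQ := AQ_pi (var a).

End AQ.

(* Main.v *)
(* The incomparable pairs of the poset have the same rank, and the relation r[l]
   contains exactly one of them, all other terms having two factors of distinct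
   ranks with the same sum. For the weight C - rank^2 this product is therefore
   the leading term of r[l], and the leading terms are pairwise coprime. The
   poset monomials are those divisible by no leading term.

   For relations r_j whose leading monomials u_j are pairwise coprime, factor each
   monomial as s * prod_j u_j^(a_j) with the a_j maximal, and let T be the linear
   map sending it to s * prod_j r_j^(a_j). T is unitriangular for the weight,
   hence bijective, it fixes the standard monomials, and T (u_j p) = r_j T p. So T
   carries the decomposition of the polynomial ring into standard monomials and
   the ideal (u_j) to its decomposition into standard monomials and the ideal
   (r_j). *)
From HB Require Import structures.
Require Import Defs.
From mathcomp Require Import all_boot all_order all_algebra.
From mathcomp Require Import reals complex mpoly.
From mathcomp Require Import ssrcomplements ring_quotient zify boolp.

Set Implicit Arguments.
Unset Strict Implicit.
Unset Printing Implicit Defensive.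

Import Order.TTheory GRing.Theory Num.Theory.
Local Open Scope ring_scope.

(** * Relations with coprime leading monomials *)

Section LinearExtension.
Variables (n : nat) (R : comNzRingType) (V : lmodType R) (phi : 'X_{1..n} -> V).

Definition mextend (p : {mpoly R[n]}) : V := \sum_(m <- msupp p) p@_m *: phi m.

(** A common degree bound puts polynomials with different supports on the same index set, which
    makes linearity a termwise check. *)
Lemma mextendwE k p : (msize p <= k)%N ->
  mextend p = \sum_(m : 'X_{1..n < k}) p@_m *: phi m.
Proof.
move=> lt_pk; rewrite /mextend (big_mksub 'X_{1..n < k}) //=; first last.
- by move=> m /msize_mdeg_lt /leq_trans; apply.
- exact: msupp_uniq.
by rewrite big_rmcond //= => i /memN_msupp_eq0 ->; rewrite scale0r.
Qed.

Fact mextend_is_linear : linear mextend.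
Proof.
move=> c p q; pose k := maxn (msize (c *: p + q)) (maxn (msize p) (msize q)).
rewrite !(@mextendwE k) ?leq_max ?leqnn ?orbT //.
rewrite scaler_sumr -big_split; apply: eq_bigr => m _.
by rewrite linearP scalerDl scalerA.
Qed.

HB.instance Definition _ :=
  GRing.isLinear.Build R {mpoly R[n]} V _ mextend mextend_is_linear.

Lemma mextendX m : mextend 'X_[m] = phi m.
Proof. by rewrite /mextend msuppX big_seq1 mcoeffX eqxx scale1r. Qed.

End LinearExtension.

(** * Weights of products and leading monomials *)

Section MeasureProduct.
Variables (n : nat) (R : comNzRingType) (mf : measure n).
Implicit Types (p q : {mpoly R[n]}) (m : 'X_{1..n}).

Lemma mmeasureP p a :
  reflect (forall m, m \in msupp p -> (mf m < a)%N) (mmeasure mf p <= a)%N.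
Proof.
apply: (iffP idP) => [h m /(mmeasure_mnm_lt mf) lt|h]; first exact: leq_trans h.
by rewrite mmeasureE big_seq; apply/bigmax_leqP_seq => m /h.
Qed.

(** Weights below [a] and weights at most [b] add up to weights below [a + b]; the excess of one in
    [mmeasure] must count only once, hence [b.+1]. *)
Lemma mmeasureM_le p q a b : (mmeasure mf p <= a)%N -> (mmeasure mf q <= b.+1)%N ->
  (mmeasure mf (p * q) <= a + b)%N.
Proof.
move=> /mmeasureP hp /mmeasureP hq; apply/mmeasureP => m.
move=> /msuppM_le /allpairsP [[m1 m2] /= [/hp h1 /hq h2 ->]].
by rewrite mfD; lia.
Qed.

(* [mmeasure] is one more than the largest weight: the terms of [p] other than
   [m] all have a smaller weight than [m]. *)
Definition leads p m := (mmeasure mf (p - 'X_[m]) <= mf m)%N.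

Lemma leads_le p m : leads p m -> (mmeasure mf p <= (mf m).+1)%N.
Proof.
move=> h; rewrite -[p](subrK 'X_[m]); apply: leq_trans (mmeasureD_le _ _ _) _.
by rewrite mmeasureX geq_max leqnn andbT; apply: leqW.
Qed.

Lemma leadsX m : leads 'X_[m] m.
Proof. by rewrite /leads subrr mmeasure0. Qed.

Lemma leadsM p q m m' : leads p m -> leads q m' -> leads (p * q) (m + m')%MM.
Proof.
move=> hp hq; rewrite /leads mpolyXD.
(* Telescoping leaves in each summand one factor whose leading term has been removed. *)
have -> : p * q - 'X_[m] * 'X_[m'] = (p - 'X_[m]) * q + (q - 'X_[m']) * 'X_[m].
  by rewrite !mulrBl [q * _]mulrC ['X_[m'] * _]mulrC addrA subrK.
apply: leq_trans (mmeasureD_le _ _ _) _; rewrite mfD geq_max.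
rewrite mmeasureM_le ?leads_le //= addnC.
by rewrite mmeasureM_le // mmeasureX.
Qed.

Lemma leads_exp p m a : leads p m -> leads (p ^+ a) (m *+ a)%MM.
Proof.
move=> hp; elim: a => [|a IH]; first by rewrite expr0 mulm0n -mpolyX0 leadsX.
by rewrite exprS mulmS leadsM.
Qed.

Lemma leads_prod (J : Type) (s : seq J) (p : J -> {mpoly R[n]}) (m : J -> 'X_{1..n}) :
  (forall j, leads (p j) (m j)) ->
  leads (\prod_(j <- s) p j) (\sum_(j <- s) m j)%MM.
Proof.
move=> h; elim/big_rec2: _ => [|j m' q _ hq]; first by rewrite -mpolyX0 leadsX.
exact: leadsM.
Qed.

End MeasureProduct.

(** * Multiplicity of one monomial in another *)

Section MonomialExponent.
Variable n : nat.
Implicit Types (u v m : 'X_{1..n}).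

(** The largest [a] such that [u] to the power [a] divides [m]. The cutoff at the degree of [m]
    makes the maximum finite and loses nothing when [u] is nonzero. *)
Definition mexp u m : nat := \max_(a < (mdeg m).+1 | (u *+ a <= m)%MM) a.

Lemma lepm_muln u m a : u != 0%MM -> (u *+ a <= m)%MM = (a <= mexp u m)%N.
Proof.
move=> u0; have [i ui] : exists i, (0 < u i)%N.
  apply/existsP; apply: contraNT u0 => /existsPn h.
  by apply/eqP/mnmP => i; rewrite mnm0E; have := h i; lia.
apply/idP/idP => [h|].
  (* Some variable [i] occurs in [u], so [a] is at most the exponent of [i] in [m], hence at most
     the degree. *)
  have lt : (a < (mdeg m).+1)%N.
    have /mnm_lepP/(_ i) := h; rewrite mulmnE mdegE (bigD1 i) //=; nia.
  exact: (@leq_bigmax_cond _ (fun b : 'I__ => u *+ b <= m)%MM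
           (fun b : 'I__ => b : nat) (Ordinal lt)).
have : (0 < #|[pred b : 'I_(mdeg m).+1 | (u *+ b <= m)%MM]|)%N.
  apply/card_gt0P; exists ord0; rewrite inE /= mulm0n; apply/mnm_lepP => k.
  by rewrite mnm0E.
rewrite /mexp => /(eq_bigmax_cond (fun b : 'I__ => b : nat)) [b hb ->] le_ab.
apply/mnm_lepP => k; have /mnm_lepP/(_ k) := hb.
by rewrite !mulmnE; apply: leq_trans; rewrite leq_mul2l le_ab orbT.
Qed.

Lemma mexp_gt0 u m : u != 0%MM -> (0 < mexp u m)%N = (u <= m)%MM.
Proof. by move=> u0; rewrite -lepm_muln // mulm1n. Qed.

Lemma mexpD u m : u != 0%MM -> mexp u (u + m) = (mexp u m).+1.
Proof.
move=> u0; apply/eqP; rewrite eqn_leq; apply/andP; split; last first.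
  rewrite -lepm_muln // mulmS; apply/mnm_lepP => i.
  have : (u *+ mexp u m <= m)%MM by rewrite lepm_muln.
  by move=> /mnm_lepP/(_ i); rewrite !mnmDE leq_add2l.
case E : (mexp u (u + m)) => [//|a]; rewrite ltnS -lepm_muln //.
have : (u *+ a.+1 <= u + m)%MM by rewrite lepm_muln // E.
move=> /mnm_lepP h; apply/mnm_lepP => i; have := h i.
by rewrite mulmS !mnmDE leq_add2l.
Qed.

(** Where [u] occurs, [v] does not change the exponent; elsewhere, divisibility by a power of [u]
    imposes no condition. *)
Lemma mexpD_coprime u v m : u != 0%MM ->
  (forall i, (u i == 0%N) || (v i == 0%N)) -> mexp u (v + m) = mexp u m.
Proof.
move=> u0 uv; suff h a : (a <= mexp u (v + m))%N = (a <= mexp u m)%N.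
  by apply/eqP; rewrite eqn_leq h -h !leqnn.
rewrite -!lepm_muln //; apply/mnm_lepP/mnm_lepP => h i; have := h i;
  by rewrite mnmDE mulmnE; have /orP[] := uv i => /eqP ->; lia.
Qed.

End MonomialExponent.

(** * The unitriangular straightening map *)

Section CoprimeLeadingMonomials.
Variables (n : nat) (R : comNzRingType) (mf : measure n) (J : finType).
Variables (u : J -> 'X_{1..n}) (r : J -> {mpoly R[n]}).
Hypothesis u_neq0 : forall j, u j != 0%MM.
Hypothesis u_coprime :
  forall j k, j != k -> forall i, (u j i == 0%N) || (u k i == 0%N).
Hypothesis r_leads : forall j, leads mf (r j) (u j).
Implicit Types (m : 'X_{1..n}) (p q : {mpoly R[n]}).

Let upart m := (\sum_j u j *+ mexp (u j) m)%MM.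

(** The [u j] have disjoint supports, so at each variable at most one summand is nonzero, and that
    one divides [m]. *)
Lemma upart_le m : (upart m <= m)%MM.
Proof.
apply/mnm_lepP => i; rewrite mnm_sumE.
have [|/existsPn h] := boolP [exists j, u j i != 0%N].
  move=> /existsP [j uj]; rewrite (bigD1 j) //= big1 ?addn0 => [|k kj].
    have : (u j *+ mexp (u j) m <= m)%MM by rewrite lepm_muln.
    by move/mnm_lepP.
  have := u_coprime kj i; rewrite (negPf uj) orbF mulmnE => /eqP ->.
  exact: mul0n.
by rewrite big1 // => j _; have := h j; rewrite negbK mulmnE => /eqP ->.
Qed.

Let rpart m := \prod_j r j ^+ mexp (u j) m.

Definition straighten m : {mpoly R[n]} := 'X_[m - upart m] * rpart m.

Lemma straighten_leads m : leads mf (straighten m) m.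
Proof.
rewrite -{2}(submK (upart_le m)) leadsM ?leadsX // leads_prod // => j.
exact: leads_exp.
Qed.

(** Multiplying by [u k] raises the exponent at [k] by one, changes no other exponent by
    coprimality, and leaves the cofactor [m - upart m] as it was. *)
Lemma straightenD k m : straighten (u k + m) = r k * straighten m.
Proof.
have exp_other j : j != k -> mexp (u j) (u k + m) = mexp (u j) m.
  by move=> jk; rewrite mexpD_coprime //; apply: u_coprime.
have upartD : upart (u k + m) = (u k + upart m)%MM.
  rewrite /upart (bigD1 k) //= [in RHS](bigD1 k) //= mexpD // mulmS -addmA.
  by congr (_ + (_ + _))%MM; apply: eq_bigr => j /exp_other ->.
have rpartD : rpart (u k + m) = r k * rpart m.
  rewrite /rpart (bigD1 k) //= [in RHS](bigD1 k) //= mexpD // exprS -mulrA.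
  by congr (_ * (_ * _)); apply: eq_bigr => j /exp_other ->.
rewrite /straighten rpartD upartD mulrCA; congr (_ * ('X_[_] * _)).
by rewrite -submDA [(u k + m)%MM]addmC addmK.
Qed.

Definition standard m := [forall j, ~~ (u j <= m)%MM].

Lemma straighten_standard m : standard m -> straighten m = 'X_[m].
Proof.
move=> /forallP h; have e j : mexp (u j) m = 0%N.
  by apply/eqP; rewrite -leqn0 leqNgt mexp_gt0.
rewrite /straighten /upart /rpart !big1 ?subm0 ?mulr1 // => j _; rewrite e //.
Qed.

Local Notation T := (mextend straighten).

(** Each monomial is moved only by terms of smaller weight. Injectivity and surjectivity of [T] both
    follow from this. *)
Lemma mextend_straighten_lt p :
  p != 0 -> (mmeasure mf (T p - p) < mmeasure mf p)%N.
Proof.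
move=> p0; rewrite (mpolySpred _ p0) ltnS; apply/mmeasureP => m0.
have -> : T p - p = \sum_(m <- msupp p) p@_m *: (straighten m - 'X_[m]).
  rewrite [X in _ - X]mpolyE /mextend -sumrB; apply: eq_bigr => m _.
  by rewrite scalerBr.
move=> /msupp_sum_le /flatten_mapP [m].
rewrite filter_predT => mp /msuppZ_le m0s.
have /mmeasureP/(_ _ m0s) := straighten_leads m.
by have := mmeasure_mnm_lt mf mp; rewrite (mpolySpred _ p0); lia.
Qed.

Lemma mextend_straighten_inj p : T p = 0 -> p = 0.
Proof.
move=> Tp; apply/eqP/negPn/negP => /mextend_straighten_lt.
by rewrite Tp sub0r mmeasureN ltnn.
Qed.

Lemma mextend_straighten_surj p : exists q, T q = p.
Proof.
have [k] := ubnP (mmeasure mf p); elim: k p => // k IH p lt_k.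
have [->|p0] := eqVneq p 0; first by exists 0; rewrite linear0.
(* The error [p - T p] has smaller measure and so has a preimage [q]; then [q + p] is a preimage of
   [p]. *)
have [|q Tq] := IH (p - T p).
  rewrite -opprB mmeasureN.
  by apply: leq_trans (mextend_straighten_lt p0) _; rewrite -ltnS.
by exists (q + p); rewrite linearD /= Tq subrK.
Qed.

Lemma mextend_straightenM k p : T ('X_[u k] * p) = r k * T p.
Proof.
elim/mpolyind: p => [|c m p _ _ IH]; first by rewrite mulr0 linear0 mulr0.
rewrite mulrDr !linearD /= mulrDr IH -scalerAr -mpolyXD !linearZ /=.
by rewrite !mextendX straightenD -scalerAr.
Qed.

Lemma mextend_straighten_id p : {subset msupp p <= standard} -> T p = p.
Proof.
move=> h; rewrite [RHS]mpolyE; apply: eq_big_seq => m /h.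
by move=> /straighten_standard ->.
Qed.

Lemma mpoly_standard_decomp p : exists q c,
  {subset msupp q <= standard} /\ p = q + \sum_j c j * 'X_[u j].
Proof.
elim/mpolyind: p => [|a m p _ _ [q [c [hq ->]]]].
  exists 0, (fun=> 0); split=> [m|]; first by rewrite msupp0.
  by rewrite add0r big1 // => j _; rewrite mul0r.
have [sm|] := boolP (standard m).
  exists (a *: 'X_[m] + q), c; rewrite addrA; split=> // m' /msuppD_le.
  by rewrite mem_cat => /orP[/msuppZ_le/mem_msuppXP <-|/hq].
move=> /forallPn [k]; rewrite negbK => /submK mk.
(* The monomial is divisible by [u k], so the cofactor at [k] absorbs it. *)
exists q, (fun j => (j == k)%:R * (a *: 'X_[m - u k]) + c j); split=> //.
rewrite addrCA; congr (_ + _).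
rewrite (eq_bigr _ (fun j _ => mulrDl _ _ _)) big_split /=; congr (_ + _).
rewrite (bigD1 k) //= eqxx mul1r big1 => [|j /negPf ->]; last by rewrite !mul0r.
by rewrite addr0 -scalerAl -mpolyXD mk.
Qed.

(** Decompose a preimage under [T] modulo the leading monomials, then apply [T], which fixes the
    standard part. *)
Lemma standard_spans p : exists q c,
  {subset msupp q <= standard} /\ p = q + \sum_j c j * r j.
Proof.
have [p' <-] := mextend_straighten_surj p.
have [q [c [hq ->]]] := mpoly_standard_decomp p'.
exists q, (fun j => T (c j)); split=> //.
rewrite linearD linear_sum /= mextend_straighten_id //; congr (_ + _).
by apply: eq_bigr => j _; rewrite mulrC mextend_straightenM mulrC.
Qed.

(** Pulled back by [T], the equation puts [q] in the ideal of the leading monomials. Every monomial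
    of such a polynomial is divisible by some [u j], so none is standard. *)
Lemma standard_indep q c :
  {subset msupp q <= standard} -> q = \sum_j c j * r j -> q = 0.
Proof.
move=> hq; have [d hd] := choice (fun j => mextend_straighten_surj (c j)).
have -> : \sum_j c j * r j = T (\sum_j d j * 'X_[u j]).
  rewrite linear_sum; apply: eq_bigr => j _ /=.
  by rewrite [d j * _]mulrC mextend_straightenM hd mulrC.
rewrite -{1}(mextend_straighten_id hq) => /eqP; rewrite -subr_eq0 -linearB /=.
move=> /eqP/mextend_straighten_inj/eqP; rewrite subr_eq0 => /eqP e.
apply/mpolyP => m; rewrite mcoeff0; apply/eqP; rewrite mcoeff_eq0.
apply/negP => mq; have /forallP sm := hq m mq.
move: mq; rewrite e => /msupp_sum_le /flatten_mapP [j _].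
rewrite (perm_mem (msuppMX _ _)) => /mapP [m' _ em].
by have := sm j; rewrite em lem_addr.
Qed.

End CoprimeLeadingMonomials.

(** * Leading terms of the relations *)

Section WeightMeasure.
Variables (n : nat) (w : 'I_n -> nat).

Definition weight_measure (m : 'X_{1..n}) : nat := \sum_i m i * w i.

Fact weight_measure0 : weight_measure 0%MM = 0%N.
Proof. by rewrite /weight_measure big1 // => i _; rewrite mnm0E. Qed.

Fact weight_measureD :
  {morph weight_measure : m1 m2 / (m1 + m2)%MM >-> (m1 + m2)%N}.
Proof.
move=> m1 m2; rewrite /weight_measure -big_split; apply: eq_bigr => i _.
by rewrite mnmDE mulnDl.
Qed.

HB.instance Definition _ :=
  isMeasure.Build n weight_measure weight_measure0 weight_measureD.

Lemma weight_measureU i : weight_measure U_(i) = w i.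
Proof.
rewrite /weight_measure (bigD1 i) //= mnm1E eqxx mul1n big1 ?addn0 // => j ji.
by rewrite mnm1E eq_sym (negPf ji).
Qed.

End WeightMeasure.

Section Presentation.
Variables (K : fieldType) (n N1 N2 : nat) (n_ge3 : (3 <= n)%N).
Local Notation gen := (gen n N1 N2).
Local Notation G := (gposet N1 N2 n_ge3).
Local Notation S := {mpoly K[#|{: gen}|]}.
Local Notation index := 'I_(2 * (N1 + N2)).+1.
Local Notation triple := (time N1 N2 * time N1 N2 * 'I_n)%type.
Implicit Types (x y : gen) (k : index) (d : triple).

Definition level k : int := k%:Z - (2 * N1)%:Z.

Definition grank x : int := rank (gen_symbol x).

(** Half of the rank sum shared by all terms of a relation, hence the rank of both factors of its
    leading term. *)
Definition lead_rank k : int := (n%:Z - 1) * (level k + 1).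

Lemma lead_rank_inj : injective lead_rank.
Proof.
move=> j k; rewrite /lead_rank /level => h; apply: val_inj => /=.
have e : (j : nat)%:Z - (k : nat)%:Z = 0 by nia.
lia.
Qed.

Definition ffactor d : gen := Sf d.2 d.1.1.
Definition gfactor d : gen := Sg d.2 d.1.2.

(** Times are stored shifted by [N1], so two times with sum [level k] have stored values with sum
    [k]. *)
Definition on_level k d : bool := (d.1.1 + d.1.2 == k :> nat)%N.

Lemma grank_factors k d : on_level k d ->
  grank (ffactor d) + grank (gfactor d) = 2 * lead_rank k.
Proof.
case: d => [[s t] i] /eqP /= e; rewrite /grank /rank /= /lead_rank /level /time_int.
by rewrite -e; nia.
Qed.

Fact lead_index_subproof k : ((if odd k then n.-1 else 0) < n)%N.
Proof.
by case: ifP => _; lia.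
Qed.

(** The leading product is f^1[t] g_1[t] at level 2t and f^n[t+1] g_n[t] at level 2t+1; [k] has the
    parity of its level. *)
Definition lead k : triple :=
  (inord (uphalf k), inord k./2, Ordinal (lead_index_subproof k)).

Definition flead k := ffactor (lead k).
Definition glead k := gfactor (lead k).

Lemma on_level_lead k : on_level k (lead k).
Proof.
have := ltn_ord k; rewrite /on_level /lead /= => lk.
have := odd_double_half k; rewrite uphalf_half -addnn => e.
by rewrite !inordK; move: e; case: odd; lia.
Qed.

Lemma grank_flead k : grank (flead k) = lead_rank k.
Proof.
have := ltn_ord k; rewrite /grank /rank /= /lead_rank /level /time_int /= => lk.
have := odd_double_half k; rewrite -addnn uphalf_half => e.
rewrite inordK; last by move: e; case: odd; lia.
by case: ifP e => _ /= e; nia.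
Qed.

Lemma grank_glead k : grank (glead k) = lead_rank k.
Proof.
have := grank_factors (on_level_lead k).
by rewrite -/(flead k) -/(glead k) grank_flead; lia.
Qed.

(** Equality of ranks reads (n-1)(s-t) = i with 0 <= i < n, which leaves s = t, i = 0 or s = t+1, i
    = n-1. The parity of [k] decides between them. *)
Lemma lead_unique k d :
  on_level k d -> grank (ffactor d) = lead_rank k -> d = lead k.
Proof.
case: d => [[s t] i]; rewrite /on_level /grank /rank /lead_rank /level /time_int /=.
move=> /eqP e h; have li := ltn_ord i.
have [] : (s = t :> nat)%N /\ i = 0%N :> nat \/ s = t.+1 :> nat /\ i.+1 = n.
- have {}h : (n%:Z - 1) * ((s : nat)%:Z - (t : nat)%:Z) = (i : nat)%:Z.
    by rewrite /time_int -e in h; nia.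
  have [d0|d0|d0] := ltrgtP ((s : nat)%:Z - (t : nat)%:Z) 0; first by nia.
    have [d1|d1] := eqVneq ((s : nat)%:Z - (t : nat)%:Z) 1; last by nia.
    by right; rewrite d1 in h; lia.
  by left; rewrite d0 in h; lia.
- move=> [st i0]; have ek : k = t.*2 :> nat by rewrite -e st addnn.
  congr (_, _, _); apply: val_inj; rewrite /= ek ?odd_double //.
    by rewrite uphalf_double st inord_val.
  by rewrite half_double inord_val.
move=> [st i_n]; have ek : k = t.*2.+1 :> nat by rewrite -e st -addnn.
congr (_, _, _); apply: val_inj; rewrite /= ek /= ?odd_double //=.
- by rewrite half_double inordK -st.
- by rewrite uphalf_double inord_val.
- by lia.
Qed.

Lemma rel_rE k : @rel_r K n N1 N2 (level k) =
  var K (flead k) * var K (glead k)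
  + \sum_(d : triple | on_level k d && (d != lead k))
      var K (ffactor d) * var K (gfactor d).
Proof.
rewrite /rel_r; under eq_bigr => s _ do rewrite pair_big /=.
rewrite pair_big_dep /=.
rewrite (reindex (fun d : triple => (d.1.1, (d.1.2, d.2)))) /=; last first.
  by exists (fun q => (q.1, q.2.1, q.2.2)); [case=> -[]|case=> ? []].
rewrite (eq_bigl (on_level k)) => [|[[s t] i]]; last first.
  by rewrite /= andbT /on_level /level /time_int /=; lia.
by rewrite (bigD1 (lead k)) ?on_level_lead.
Qed.

(** The constant C of the weight, large enough for the truncated subtraction in [gweight] to be
    exact. *)
Definition max_sqrank : nat := \max_(x : gen) `|grank x| ^ 2.

(* The ranks of the two factors of a term of a relation have a constant sum, so
   by strict concavity the term with equal ranks has the largest weight. *)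
Definition gweight x : nat := max_sqrank - `|grank x| ^ 2.

Lemma gweightE x : (gweight x + `|grank x| ^ 2)%N = max_sqrank.
Proof. by rewrite subnK // /max_sqrank leq_bigmax. Qed.

Definition gmeasure : measure #|{: gen}| :=
  weight_measure (fun i => gweight (enum_val i)).

Definition lead_mnm k : 'X_{1..#|{: gen}|} :=
  (U_(enum_rank (flead k)) + U_(enum_rank (glead k)))%MM.

Lemma gmeasureU x : gmeasure U_(enum_rank x)%MM = gweight x.
Proof. by rewrite /gmeasure /= weight_measureU enum_rankK. Qed.

Lemma rel_r_leads k : leads gmeasure (@rel_r K n N1 N2 (level k)) (lead_mnm k).
Proof.
rewrite /leads rel_rE /lead_mnm mpolyXD addrC addKr.
apply: leq_trans (mmeasure_sum _ _ _ _) _.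
apply/bigmax_leqP => d /andP[dk d_lead].
rewrite /var -mpolyXD mmeasureX !mfD !gmeasureU.
have e := grank_factors dk; have f0 := grank_flead k; have g0 := grank_glead k.
have ne : grank (ffactor d) != lead_rank k.
  by apply: contra d_lead => /eqP /(lead_unique dk) ->.
have := gweightE (ffactor d); have := gweightE (gfactor d).
have := gweightE (flead k); have := gweightE (glead k).
rewrite f0 g0.
move: (gweight _) (gweight _) (gweight _) (gweight _) => a b c d'.
(* If f + g = 2l and f differs from l, then f^2 + g^2 - 2l^2 = 2(f-l)^2 is positive. *)
by have : (2 * `|lead_rank k| ^ 2 < `|grank (ffactor d)| ^ 2 + `|grank (gfactor d)| ^ 2)%N; nia.
Qed.

(** * Incomparable pairs and standard monomials *)

Lemma gle_grank (a b : G) : (a <= b)%O <-> a = b \/ grank a < grank b.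
Proof. by split => /gleP. Qed.

Lemma incomparableP (a b : G) : reflect (a <> b /\ grank a = grank b) (~~ (a >=< b)%O).
Proof.
apply: (iffP idP) => [|[ab e]]; last first.
  by apply/negP => /orP[] /gle_grank []; [|rewrite e ltxx|move/esym|rewrite e ltxx].
rewrite negb_or => /andP[/negP ab /negP ba]; split.
  by move=> e; apply: ab; apply/gle_grank; left.
case: (ltrgtP (grank a) (grank b)) => // h.
  by case: ab; apply/gle_grank; right.
by case: ba; apply/gle_grank; right.
Qed.

Lemma lead_incomparable k : ~~ ((flead k : G) >=< (glead k : G))%O.
Proof. by apply/incomparableP; rewrite grank_flead grank_glead. Qed.

(** Distinct generators of equal rank are an [f] and a [g] with the same index; at the level given
    by the sum of their times, [lead_unique] identifies them with the leading pair. *)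
Lemma incomparable_lead (a b : G) : ~~ (a >=< b)%O -> exists k,
  (a = flead k /\ b = glead k) \/ (a = glead k /\ b = flead k).
Proof.
have fg (i j : 'I_n) (s t : time N1 N2) :
    grank (Sf i s) = grank (Sg j t) -> exists k, Sf i s = flead k /\ Sg j t = glead k.
  move=> e; have ij : i = j.
    have /(same_rank n_ge3) [//|[i0 [i1 [t0 [[_ _]|[_ _]]]]]] := e;
      by case=> -[] // [-> _] [->].
  subst j; have lt_k : (s + t < (2 * (N1 + N2)).+1)%N.
    by have := ltn_ord s; have := ltn_ord t; lia.
  pose k : index := Ordinal lt_k; exists k.
  have on : on_level k (s, t, i) by rewrite /on_level.
  have := grank_factors on; rewrite /ffactor /gfactor /= -e => e2.
  have h : grank (ffactor (s, t, i)) = lead_rank k by rewrite /ffactor /=; lia.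
  by rewrite /flead /glead -(lead_unique on h).
move=> /incomparableP [ab e].
have [ab'|] := same_rank n_ge3 e; first by case: ab; exact: gen_symbol_inj ab'.
case: a b ab e => i s [] j t ab e [i0 [i1 [t0 H]]].
- by case: H => -[_ _ [] []].
- by have [k [-> ->]] := fg _ _ _ _ e; exists k; left.
- by have [k [-> ->]] := fg _ _ _ _ (esym e); exists k; right.
- by case: H => -[_ _ [] []].
Qed.

Lemma lead_mnm_neq0 k : lead_mnm k != 0%MM.
Proof. by rewrite mnmD_eq0 mnm1_eq0. Qed.

(** Both generators in a leading monomial have rank [lead_rank], which differs from one relation to
    another. *)
Lemma lead_mnm_coprime j k : j != k ->
  forall i, (lead_mnm j i == 0%N) || (lead_mnm k i == 0%N).
Proof.
move=> jk i; have supp l : lead_mnm l i != 0%N -> grank (enum_val i) = lead_rank l.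
  rewrite mnmDE !mnm1E addn_eq0 negb_and !eqb0 !negbK.
  by case/orP => /eqP <-; rewrite enum_rankK ?grank_flead ?grank_glead.
have [//|/supp ej] := eqVneq (lead_mnm j i) 0%N.
have [//|/supp ek] := eqVneq (lead_mnm k i) 0%N.
by rewrite (lead_rank_inj (etrans (esym ej) ek)) eqxx in jk.
Qed.

Definition mnm_of (m : {ffun gen -> nat}) : 'X_{1..#|{: gen}|} :=
  [multinom m (enum_val i) | i < _].

Lemma mnm_of_inj : injective mnm_of.
Proof.
move=> m m' /mnmP h; apply/ffunP => x.
by have := h (enum_rank x); rewrite !mnmE enum_rankK.
Qed.

Lemma mnm_of_surj m : exists m', mnm_of m' = m.
Proof.
exists [ffun x => m (enum_rank x)]; apply/mnmP => i.
by rewrite mnmE ffunE enum_valK.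
Qed.

Lemma monomial_var m : monomial (@var K n N1 N2) m = 'X_[mnm_of m].
Proof.
rewrite mpolyXE_id /monomial (reindex _ (onW_bij _ (enum_val_bij gen))).
by apply: eq_bigr => i _; rewrite /var enum_valK mnmE.
Qed.

(** A leading monomial divides [m] exactly when both of its generators occur in [m], and the leading
    pairs are exactly the incomparable pairs. *)
Lemma standard_mnm_of (m : {ffun gen -> nat}) :
  standard lead_mnm (mnm_of m) = comparable_support (m : {ffun G -> nat}).
Proof.
have lead_le k : (lead_mnm k <= mnm_of m)%MM = (m (flead k) != 0%N) && (m (glead k) != 0%N).
  have fg : (enum_rank (flead k) == enum_rank (glead k)) = false.
    by rewrite (inj_eq enum_rank_inj).
  apply/mnm_lepP/andP => [h|[hf hg] i].
    have := h (enum_rank (flead k)); have := h (enum_rank (glead k)).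
    rewrite !mnmDE !mnm1E !mnmE !enum_rankK !eqxx fg eq_sym fg; lia.
  rewrite mnmDE !mnm1E mnmE.
  case: eqP => [<-|_]; first by rewrite eq_sym fg enum_rankK lt0n.
  by case: eqP => [<-|_] //; rewrite enum_rankK lt0n.
apply/forallP/forallP => h.
  move=> a; apply/forallP => b; apply/implyP => /andP[ma mb].
  apply/negPn/negP => /incomparable_lead [k ab].
  by have := h k; rewrite lead_le; case: ab => -[ea eb]; rewrite -ea -eb ma mb.
move=> k; rewrite lead_le; apply/negP => mm.
have /forallP/(_ (glead k)) := h (flead k); rewrite mm /=.
exact/negP/lead_incomparable.
Qed.

End Presentation.

(** * The quotient algebra *)

Section Quotient.
Variables (K : fieldType) (n N1 N2 : nat) (n_ge3 : (3 <= n)%N).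
Local Notation gen := (gen n N1 N2).
Local Notation G := (gposet N1 N2 n_ge3).
Local Notation S := {mpoly K[#|{: gen}|]}.
Local Notation index := 'I_(2 * (N1 + N2)).+1.
Local Notation AQ := (AQ K n N1 N2).
Local Notation pi := (@AQ_pi K n N1 N2).
Local Notation r k := (@rel_r K n N1 N2 (level k)).
Local Notation u := (@lead_mnm n N1 N2 n_ge3).
Implicit Types (p q : S) (k : index).

Lemma AQ_pi_eq0 p : pi p = 0 <-> exists c : index -> S, p = \sum_k c k * r k.
Proof.
have -> : (pi p = 0) <-> p \in @AQ_ideal K n N1 N2.
  have -> : (p \in @AQ_ideal K n N1 N2) = (p - 0 \in @AQ_ideal K n N1 N2).
    by rewrite subr0.
  rewrite Quotient.idealrBE; split=> [h|/eqP h].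
    by apply/eqP; rewrite [LHS]h /AQ_pi raddf0.
  by rewrite /AQ_pi h raddf0.
split=> [/asboolP [c ->]|[c ->]]; first by exists c.
apply/asboolP; exists (fun l : nat => c (inord l)).
by apply: eq_bigr => k _; rewrite inord_val.
Qed.

Lemma AQ_pi_rel k : pi (r k) = 0.
Proof.
apply/AQ_pi_eq0; exists (fun j => (j == k)%:R).
by rewrite (bigD1 k) //= eqxx mul1r big1 ?addr0 // => j /negPf ->; rewrite mul0r.
Qed.

Lemma AQ_pi_surj v : exists p, v = pi p.
Proof. by exists (repr v); rewrite /AQ_pi reprK. Qed.

Lemma AQ_pi_standard_indep q :
  {subset msupp q <= standard u} -> pi q = 0 -> q = 0.
Proof.
move=> hq /AQ_pi_eq0 [c]; apply: (standard_indep _ _ _ hq).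
- exact: lead_mnm_neq0.
- exact: lead_mnm_coprime.
- exact: rel_r_leads.
Qed.

Lemma AQ_pi_standard_spans v : exists q,
  {subset msupp q <= standard u} /\ v = pi q.
Proof.
have [p ->] := AQ_pi_surj v.
have [q [c [hq ->]]] := standard_spans (lead_mnm_neq0 n_ge3)
  (lead_mnm_coprime n_ge3) (rel_r_leads K n_ge3) p.
exists q; split=> //; rewrite raddfD raddf_sum /= big1 ?addr0 // => k _.
by rewrite rmorphM /= AQ_pi_rel mulr0.
Qed.

Lemma monomial_basis : is_basis (fun m : poset_monomial G =>
  pi (monomial (@var K n N1 N2) (val m))) (fun=> True).
Proof.
pose M (m : poset_monomial G) := mnm_of (val m : {ffun gen -> nat}).
have M_inj : injective M by move=> m m' /mnm_of_inj/val_inj.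
have M_std m : standard u (M m) by rewrite standard_mnm_of; apply: valP m.
have piM m : pi (monomial (@var K n N1 N2) (val m)) = pi 'X_[M m].
  by rewrite monomial_var.
split.
  move=> s c s_uniq; under eq_bigr => m _ do rewrite piM -linearZ.
  rewrite -linear_sum /= => /AQ_pi_standard_indep e m ms.
  have {e} : \sum_(i <- s) c i *: 'X_[M i] = 0 :> S.
    apply: e => m' /msupp_sum_le /flatten_mapP [i _] /msuppZ_le.
    by move=> /mem_msuppXP <-; apply: M_std.
  move=> /(congr1 (mcoeff (M m))); rewrite mcoeff0 raddf_sum /= => <-.
  rewrite (bigD1_seq m) //= mcoeffZ mcoeffX eqxx mulr1 big1 ?addr0 // => i im.
  by rewrite mcoeffZ mcoeffX (inj_eq M_inj) (negPf im) mulr0.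
move=> v; split=> // _; have [q [hq ->]] := AQ_pi_standard_spans v.
have [M' M'K] : exists M', {in msupp q, cancel M' M}.
  have [M0 M0K] := choice (@mnm_of_surj n N1 N2).
  (* The constant monomial is the default value of [M'] where the exponents do not form a poset
     monomial. *)
  have [m0 hm0] : exists m0 : {ffun G -> nat}, comparable_support m0.
    exists [ffun=> 0%N]; apply/forallP => a; apply/forallP => b.
    by rewrite ffunE eqxx.
  exists (fun m => insubd (exist _ m0 hm0 : poset_monomial G) (M0 m)) => m mq.
  have m_comp : comparable_support (M0 m : {ffun G -> nat}).
    by rewrite -standard_mnm_of M0K; apply: hq.
  by rewrite /M insubdK ?M0K.
exists (map M' (msupp q)), (fun m => q@_(M m)).
rewrite big_map {1}[q]mpolyE linear_sum; apply: eq_big_seq => m mq /=.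
by rewrite piM M'K // linearZ.
Qed.

(** * The grading and the generators of degree one *)

Lemma dhomog_rel_r k : r k \is 2.-homog.
Proof.
rewrite (rel_rE K n_ge3) /var -mpolyXD rpredD //.
  by rewrite dhomogX /= mdegD !mdeg1.
by apply: rpred_sum => d _; rewrite -mpolyXD dhomogX /= mdegD !mdeg1.
Qed.

(** The ideal is homogeneous. With each cofactor split into homogeneous parts, every product with a
    relation is homogeneous, so the projection keeps it whole or kills it. *)
Lemma AQ_pi_pihomog d p : pi p = 0 -> pi (pihomog mdeg d p) = 0.
Proof.
move=> /AQ_pi_eq0 [c ->]; rewrite (linear_sum (pihomog mdeg d)) linear_sum big1 // => k _ /=.
rewrite [c k](@pihomog_partitionE _ _ mdeg (msize (c k))) //.
rewrite mulr_suml (linear_sum (pihomog mdeg d)) linear_sum big1 // => i _ /=.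
set p' := pihomog _ i _ * _.
have hom : p' \is (i + 2).-homog.
  by apply: dhomogM; [exact: pihomogP|exact: dhomog_rel_r].
have [<-|ne] := eqVneq (i + 2)%N d.
  by rewrite pihomog_dE // rmorphM /= AQ_pi_rel mulr0.
by rewrite (pihomog_ne0 ne) // linear0.
Qed.

Lemma AQ_is_grading : is_grading (@AQ_grading K n N1 N2).
Proof.
split.
- by move=> d; exists 0; rewrite ?rpred0 ?linear0.
- move=> d a x y [p hp ->] [q hq ->]; exists (a *: p + q); last by rewrite linearP.
  by rewrite rpredD ?rpredZ.
- by exists 1; rewrite ?dhomog1 ?rmorph1.
- move=> d d' x y [p hp ->] [q hq ->]; exists (p * q); last by rewrite rmorphM.
  exact: dhomogM.
- move=> b; have [p ->] := AQ_pi_surj b; exists (msize p).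
  exists (fun d => pi (pihomog mdeg d p)); split=> [d|].
    by exists (pihomog mdeg d p); rewrite ?pihomogP.
  by rewrite -linear_sum -pihomog_partitionE.
move=> m c hc.
have /choice [p hp] d : exists p : S, p \is d.-homog /\ c d = pi p.
  by have [p] := hc d; exists p.
move=> c0 d lt_d; have [hom ->] := hp d.
have : pi (\sum_(i < m) p i) = 0.
  by rewrite linear_sum -[RHS]c0; apply: eq_bigr => i _; have [_ ->] := hp i.
(* Projection to degree [d] preserves the kernel and singles out the summand [p d]. *)
move=> /(AQ_pi_pihomog d); rewrite (linear_sum (pihomog mdeg d)).
rewrite (bigD1 (Ordinal lt_d)) //=.
rewrite pihomog_dE // big1 ?addr0 // => i id; have [homi _] := hp i.
by apply: pihomog_ne0 homi.
Qed.

Lemma AQ_generated : generates (@AQ_grading K n N1 N2 1).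
Proof.
move=> P [P1 PZD PM] gr1 b; have [p ->] := AQ_pi_surj b.
have P0 : 0 \in P by have := PZD (-1) _ _ P1 P1; rewrite scaleN1r addNr.
elim/mpolyind: p => [|c m p _ _ IH]; first by rewrite linear0.
rewrite linearP PZD // mpolyXE_id rmorph_prod /=.
apply: (big_ind (fun x => x \in P)) => // i _; rewrite rmorphXn /=.
elim: (m i) => [|a IHa]; first by rewrite expr0.
rewrite exprS PM // gr1 //; exists 'X_i => //.
by rewrite dhomogX /= mdeg1.
Qed.

(** Leading monomials have degree two and cannot divide a variable. This keeps the generators
    independent in the quotient. *)
Lemma standardU i : standard u U_(i).
Proof.
apply/forallP => k; apply/negP => /mnm_lepP h.
have : (\sum_j lead_mnm n_ge3 k j <= \sum_j U_(i)%MM j)%N by apply: leq_sum.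
by rewrite -!mdegE mdegD !mdeg1.
Qed.

Lemma AQ_gen_basis :
  is_basis (@AQ_gen K n N1 N2 : G -> AQ) (@AQ_grading K n N1 N2 1).
Proof.
split.
  move=> s c s_uniq; under eq_bigr => x _ do rewrite /AQ_gen -linearZ.
  rewrite -linear_sum /= => /AQ_pi_standard_indep e x xs.
  have {e} : \sum_(y <- s) c y *: var K y = 0 :> S.
    apply: e => m' /msupp_sum_le /flatten_mapP [i _] /msuppZ_le.
    by move=> /mem_msuppXP <-; apply: standardU.
  move=> /(congr1 (mcoeff U_(enum_rank (x : gen)))).
  rewrite mcoeff0 raddf_sum /= => <-.
  rewrite (bigD1_seq x) //= mcoeffZ mcoeffXU eqxx mulr1 big1 ?addr0 // => y yx.
  by rewrite mcoeffZ mcoeffXU (inj_eq enum_rank_inj) (negPf yx) mulr0.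
move=> v; split=> [[p hp ->]|[s [c ->]]]; last first.
  exists (\sum_(x <- s) c x *: var K x).
    by apply: rpred_sum => x _; rewrite rpredZ // dhomogX /= mdeg1.
  by rewrite linear_sum; apply: eq_bigr => x _; rewrite linearZ.
exists (enum {: gen}), (fun x => p@_U_(enum_rank x)).
under eq_bigr => x _ do rewrite /AQ_gen -linearZ.
rewrite -linear_sum /=; congr pi; apply/mpolyP => m.
rewrite raddf_sum /=; under eq_bigr => x _ do rewrite mcoeffZ mcoeffX.
have [/mdeg1P [i /eqP ->]|m1] := boolP (mdeg m == 1%N); last first.
  rewrite (dhomog_nemf_coeff hp m1) big1 // => x _.
  have [e|_] := eqVneq U_(enum_rank x)%MM m; last by rewrite mulr0.
  by rewrite -e mdeg1 in m1.
rewrite big_enum (bigD1 (enum_val i)) //= enum_valK eqxx mulr1 big1 ?addr0 //.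
by move=> x xi; rewrite eq_mnm1 -(inj_eq enum_val_inj) enum_rankK (negPf xi) mulr0.
Qed.

(** * Straightening relations *)

Definition straightened_form (a b : G) (v : AQ) : Prop :=
  exists c : G -> G -> K, v = \sum_(x : G | (a <= x)%O) \sum_(y : G | (y <= b)%O)
    c x y *: (AQ_gen K (x : gen) * AQ_gen K (y : gen)).

Lemma straightened_formD a b v w :
  straightened_form a b v -> straightened_form a b w ->
  straightened_form a b (v + w).
Proof.
move=> [c ->] [d ->]; exists (fun x y => c x y + d x y).
rewrite -big_split; apply: eq_bigr => x _; rewrite -big_split /=.
by apply: eq_bigr => y _; rewrite scalerDl.
Qed.

Lemma straightened_formN a b v :
  straightened_form a b v -> straightened_form a b (- v).
Proof.
move=> [c ->]; exists (fun x y => - c x y).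
rewrite -sumrN; apply: eq_bigr => x _; rewrite -sumrN.
by apply: eq_bigr => y _; rewrite scaleNr.
Qed.

Lemma straightened_form0 a b : straightened_form a b 0.
Proof.
exists (fun _ _ => 0); rewrite big1 // => x _.
by rewrite big1 // => y _; rewrite scale0r.
Qed.

Lemma straightened_formM a b (x y : G) : (a <= x)%O -> (y <= b)%O ->
  straightened_form a b (AQ_gen K (x : gen) * AQ_gen K (y : gen)).
Proof.
move=> ax yb; exists (fun x' y' => ((x' == x) && (y' == y))%:R).
rewrite (bigD1 x) //= (bigD1 y) //= !eqxx scale1r.
rewrite [X in _ = _ + X + _]big1 => [|y' /andP[_ /negPf ->]]; last first.
  by rewrite andbF scale0r.
rewrite big1 ?addr0 // => x' /andP[_ /negPf ->].
by rewrite big1 // => y' _; rewrite scale0r.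
Qed.

(** Solve the relation for its leading product. In every other term the two ranks differ and sum to
    twice [lead_rank], so one factor lies above the join and the other below the meet. *)
Lemma AQ_straightening k :
  straightened_form ((flead n_ge3 k : G) `|` (glead n_ge3 k : G))%O
                    ((flead n_ge3 k : G) `&` (glead n_ge3 k : G))%O
    (AQ_gen K (flead n_ge3 k) * AQ_gen K (glead n_ge3 k)).
Proof.
set J := (_ `|` _)%O; set M := (_ `&` _)%O.
have geJ x : lead_rank n k < grank x -> (J <= (x : G))%O.
  by move=> h; rewrite leUx; apply/andP; split; apply/gle_grank; right;
    rewrite ?grank_flead ?grank_glead.
have leM x : grank x < lead_rank n k -> ((x : G) <= M)%O.
  by move=> h; rewrite lexI; apply/andP; split; apply/gle_grank; right;
    rewrite ?grank_flead ?grank_glead.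
have /eqP := AQ_pi_rel k.
rewrite (rel_rE K n_ge3) raddfD /= rmorphM addr_eq0 => /eqP ->.
apply: straightened_formN; rewrite raddf_sum /=; apply: big_ind.
- exact: straightened_form0.
- exact: straightened_formD.
move=> d /andP[dk d_lead]; rewrite rmorphM.
have e := grank_factors n_ge3 dk.
have ne : grank (ffactor d) != lead_rank n k.
  by apply: contra d_lead => /eqP /(lead_unique n_ge3 dk) ->.
case: (ltrgtP (grank (ffactor d)) (lead_rank n k)) => h.
- by rewrite mulrC; apply: straightened_formM; [apply: geJ; lia|apply: leM].
- by apply: straightened_formM; [apply: geJ|apply: leM; lia].
by rewrite h eqxx in ne.
Qed.

Lemma AQ_straightened_law :
  straightened_law G (@AQ_grading K n N1 N2) (@AQ_gen K n N1 N2).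
Proof.
split.
- exact: AQ_is_grading.
- exact: AQ_generated.
- exact: AQ_gen_basis.
(* The product of join and meet already occurs in the double sum, so its separate coefficient is
   taken to be 0. *)
- move=> a b /incomparable_lead [k H]; exists 0.
  have [c ck] := AQ_straightening k; exists c; rewrite scale0r add0r.
  by case: H => -[-> ->] //; rewrite mulrC joinC meetC.
have -> : (fun m : poset_monomial G => monomial (@AQ_gen K n N1 N2) (val m)) =
          (fun m => pi (monomial (@var K n N1 N2) (val m))).
  apply/funext => m; rewrite /monomial rmorph_prod.
  by apply: eq_bigr => x _; rewrite rmorphXn.
exact: monomial_basis.
Qed.

End Quotient.

Theorem theorem9 (R : realType) (n N1 N2 : nat) (n_ge3 : (3 <= n)%N) :
  is_basis
    (fun m : poset_monomial (gposet N1 N2 n_ge3) =>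
       AQ_pi (monomial (@var R[i] n N1 N2) (val m)) : AQ R[i] n N1 N2)
    (fun=> True)
  /\ straightened_law (gposet N1 N2 n_ge3)
       (@AQ_grading R[i] n N1 N2) (@AQ_gen R[i] n N1 N2).
Proof. by split; [exact: monomial_basis|exact: AQ_straightened_law]. Qed.
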